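(* Let $K$ be a field, $S=K[x_1,\ldots,x_n]$ the polynomial ring, and let $\Gamma\subset\mathbb{N}_\infty^n$ be a multicomplex. Then $\Gamma$ is shellable if and only if $S/I(\Gamma)$ is a multigraded pretty clean ring.
   Context: $\mathbb{N}=\{0,1,2,\dots\}$, $\mathbb{N}_\infty=\mathbb{N}\cup\{\infty\}$, and $\mathbb{N}_\infty^n$ is ordered componentwise, with $a\le\infty$ for all $a$. A sequence $a_1\le a_2\le\cdots$ in $\mathbb{N}_\infty^n$ has a componentwise limit in $\mathbb{N}_\infty^n$. A subset $\Gamma\subset\mathbb{N}_\infty^n$ is a multicomplex if (1) $a\in\Gamma$, $b\in\mathbb{N}_\infty^n$, $b\le a$ imply $b\in\Gamma$; and (2) $\Gamma$ contains the limit of every ascending sequence $a_1\le a_2\le\cdots$ of elements of $\Gamma$. For a subset $A\subset \mathbb{N}_\infty^n$, $\Gamma(A)$ denotes the smallest multicomplex containing $A$; $\Gamma(a_1,\dots,a_k)=\Gamma(\{a_1,\dots,a_k\})=\{b: b\le a_i\text{ for some }i\}$ (empty if $k=0$). For $a\in\mathbb{N}_\infty^n$ put $\operatorname{infpt}a=\{i: a(i)=\infty\}$. Let $\mathcal{M}(\Gamma)$ be the set of maximal elements of $\Gamma$. An element $a\in\Gamma$ is a facet of $\Gamma$ if $\operatorname{infpt}a=\operatorname{infpt}m$ for all $m\in\mathcal{M}(\Gamma)$ with $a\le m$. Every multicomplex has only finitely many facets. A Stanley set is a subset of $\mathbb{N}_\infty^n$ of the form $T=a+T^*$ with $a\in\mathbb{N}^n$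 and $T^*=\Gamma(m)$ for some $m\in\mathbb{N}_\infty^n$ with $m(i)\in\{0,\infty\}$ for all $i$. The multicomplex $\Gamma$ is shellable if its facets can be ordered $a_1,\dots,a_r$ such that (1) $S_i=\Gamma(a_i)\setminus\Gamma(a_1,\dots,a_{i-1})$ is a Stanley set for $i=1,\dots,r$; and (2) whenever $S_i^*\subset S_j^*$, then $S_i^*=S_j^*$ or $i>j$. $I(\Gamma)\subset S$ is the monomial ideal spanned over $K$ by all monomials $x^a$ with $a\in\mathbb{N}^n\setminus\Gamma$. For a monomial ideal $I\subset S$, $S/I$ is a multigraded pretty clean ring if there is a filtration $0=M_0\subset M_1\subset\cdots\subset M_r=S/I$ by multigraded ($\mathbb{Z}^n$-graded) submodules with multigraded isomorphisms $M_i/M_{i-1}\cong S/P_i(-b_i)$, $b_i\in\mathbb{Z}^n$, $P_i$ a monomial prime ideal, such that for all $i<j$ with $P_i\subset P_j$ one has $P_i=P_j$. *)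

(* Defs.v *)
From HB Require Import structures.
From mathcomp Require Import all_boot all_order all_algebra.
From mathcomp Require Import generic_quotient ring_quotient.
From mathcomp Require Import boolp classical_sets.
From mathcomp Require Import mpoly.

Set Implicit Arguments.
Unset Strict Implicit.
Unset Printing Implicit Defensive.

Import GRing.Theory.

Local Open Scope ring_scope.
Local Open Scope quotient_scope.
Local Open Scope classical_set_scope.

(* [None] stands for infinity. *)
Notation natinf := (option nat).
Notation nvec n := {ffun 'I_n -> natinf}.

Definition ninf_le (a b : natinf) : bool :=
  match a, b with
  | _, None => true
  | None, Some _ => false
  | Some p, Some q => (p <= q)%N
  end.

Definition ninf_add (a b : natinf) : natinf :=
  if a is Some p then if b is Some q then Some (p + q)%N else None else None.

Section Multicomplex.
Variable n : nat.
Implicit Types (a b m l : nvec n) (A G T : set (nvec n)).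

Definition vec_le a b : bool := [forall i, ninf_le (a i) (b i)].

Definition vec_add a b : nvec n := [ffun i => ninf_add (a i) (b i)].

(* N^n is represented by the monomial exponents ['X_{1..n}]. *)
Definition fin_vec (e : 'X_{1..n}) : nvec n := [ffun i => Some (e i)].

Definition ascending (u : nat -> nvec n) : Prop :=
  forall k, vec_le (u k) (u k.+1).

(* Convergence in each coordinate, N_oo being the one-point compactification
   of the discrete space N. *)
Definition is_limit (u : nat -> nvec n) l : Prop :=
  forall i, match l i with
    | Some q => exists N, forall k, (N <= k)%N -> u k i = Some q
    | None => forall p, exists N, forall k, (N <= k)%N ->
        ninf_le (Some p) (u k i)
    end.

Definition is_multicomplex G : Prop :=
  (forall a b, G a -> vec_le b a -> G b) /\
  (forall u l, (forall k, G (u k)) -> ascending u -> is_limit u l -> G l).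

Definition mc_gen A : set (nvec n) :=
  [set b | forall G, is_multicomplex G -> A `<=` G -> G b].

Definition infpt a : set 'I_n := [set i | a i = None].

Definition maximal_elts G : set (nvec n) :=
  [set m | G m /\ forall b, G b -> vec_le m b -> b = m].

Definition facet G a : Prop :=
  G a /\ forall m, maximal_elts G m -> vec_le a m -> infpt a = infpt m.

(* [T = e + Tstar]; such an [e] and [Tstar] are determined by [T]. *)
Definition stanley_with T Tstar : Prop :=
  exists (e : 'X_{1..n}) m,
    [/\ forall i, m i = Some 0%N \/ m i = None,
        Tstar = mc_gen [set m]
      & T = [set vec_add (fin_vec e) t | t in Tstar]].

Definition stanley_set T : Prop := exists Tstar, stanley_with T Tstar.

(* The index [i] starts at 0 and the default value of [nth] is never used. *)
Definition shell_part (s : seq (nvec n)) (i : nat) : set (nvec n) :=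
  mc_gen [set nth [ffun=> None] s i] `\` mc_gen [set` take i s].

Definition is_shelling (s : seq (nvec n)) : Prop :=
  (forall i, (i < size s)%N -> stanley_set (shell_part s i)) /\
  (forall i j Ti Tj, (i < size s)%N -> (j < size s)%N ->
     stanley_with (shell_part s i) Ti -> stanley_with (shell_part s j) Tj ->
     Ti `<=` Tj -> Ti = Tj \/ (j < i)%N).

Definition shellable G : Prop :=
  exists s : seq (nvec n),
    [/\ uniq s, forall a, a \in s <-> facet G a & is_shelling s].

End Multicomplex.

Record multicomplex (n : nat) := Multicomplex {
  mc_set :> set (nvec n);
  mc_setP : is_multicomplex mc_set }.

Section Modules.
Variables (R : nzRingType) (V : lmodType R).

Record submod_of (N : submodClosed V) :=
  Submod { submod_val : V; _ : submod_val \in N }.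

HB.instance Definition _ (N : submodClosed V) :=
  [isSub of submod_of N for @submod_val N].
HB.instance Definition _ (N : submodClosed V) :=
  [Choice of submod_of N by <:].
HB.instance Definition _ (N : submodClosed V) :=
  GRing.SubChoice_isSubLmodule.Build R V _ (submod_of N)
    (GRing.subsemimodClosedP N).

Section Quotient.
Variable N : submodClosed V.

(* [N] again, so as to give it the closure under opposites which its class
   lacks but [Quotient.quot] needs. *)
Definition submod_pred : V -> bool := fun x => x \in N.

Fact submod_pred_closed : GRing.subsemimod_closed submod_pred.
Proof. exact: GRing.subsemimodClosedP. Qed.

HB.instance Definition _ :=
  GRing.isSubmodClosed.Build R V submod_pred submod_pred_closed.

Definition quotmod := Quotient.quot (GRing.ZmodClosed.clone V submod_pred _).

HB.instance Definition _ := Choice.on quotmod.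
HB.instance Definition _ := GRing.Zmodule.on quotmod.

Definition modproj (x : V) : quotmod := \pi x.
Definition modrepr (x : quotmod) : V := repr x.

Lemma modreprK : cancel modrepr modproj.
Proof. by move=> x; apply: reprK. Qed.

Lemma modproj_eq x y : (modproj x == modproj y) = (x - y \in N).
Proof. by rewrite /modproj -Quotient.idealrBE. Qed.

Fact modproj_is_zmod_morphism : zmod_morphism modproj.
Proof. by move=> x y; rewrite /modproj raddfB. Qed.

HB.instance Definition _ :=
  GRing.isZmodMorphism.Build V quotmod modproj modproj_is_zmod_morphism.

Definition quot_scale (a : R) (x : quotmod) : quotmod :=
  modproj (a *: modrepr x).

Fact modproj_scale a x : modproj (a *: x) = quot_scale a (modproj x).
Proof.
apply/eqP; rewrite modproj_eq -scalerBr rpredZ //.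
by rewrite -modproj_eq modreprK.
Qed.

Fact quot_scaleA a b x : quot_scale a (quot_scale b x) = quot_scale (a * b) x.
Proof. by rewrite -[x]modreprK -!modproj_scale scalerA. Qed.

Fact quot_scale1 : left_id 1 quot_scale.
Proof. by move=> x; rewrite -[x]modreprK -modproj_scale scale1r. Qed.

Fact quot_scaleDr : right_distributive quot_scale +%R.
Proof.
move=> a x y; rewrite -[x]modreprK -[y]modreprK -raddfD -!modproj_scale -raddfD.
by rewrite scalerDr.
Qed.

Fact quot_scaleDl x : {morph quot_scale^~ x : a b / a + b}.
Proof.
by move=> a b; rewrite -[x]modreprK -!modproj_scale -raddfD scalerDl.
Qed.

HB.instance Definition _ := GRing.Zmodule_isLmodule.Build R quotmod
  quot_scaleA quot_scale1 quot_scaleDr quot_scaleDl.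

HB.instance Definition _ :=
  GRing.isScalable.Build R V quotmod *:%R modproj modproj_scale.

End Quotient.
End Modules.

Section Subquotients.
Variables (R : nzRingType) (V : lmodType R).

Definition submod_in_pred (N N' : submodClosed V) : submod_of N -> bool :=
  fun x => val x \in N'.

Fact submod_in_pred_closed N N' : GRing.subsemimod_closed (@submod_in_pred N N').
Proof.
have inE x : (x \in @submod_in_pred N N') = (val x \in N') by [].
split; first split; first by rewrite inE raddf0 rpred0.
  by move=> x y; rewrite !inE raddfD; apply: rpredD.
by move=> a x; rewrite !inE linearZ; apply: rpredZ.
Qed.

HB.instance Definition _ N N' :=
  GRing.isSubmodClosed.Build R (submod_of N) (@submod_in_pred N N')
    (submod_in_pred_closed N N').

Definition submod_in (N N' : submodClosed V) : submodClosed (submod_of N) :=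
  GRing.SubmodClosed.clone R (submod_of N) (@submod_in_pred N N') _.

Definition subquot (N N' : submodClosed V) := quotmod (submod_in N N').

HB.instance Definition _ N N' := GRing.Lmodule.on (subquot N N').

End Subquotients.

Notation zdeg n := {ffun 'I_n -> int}.

Section Graded.
Variables (K : fieldType) (n : nat).
Local Notation S := {mpoly K[n]}.

(* [gr d] is the component of degree [d]; the gradings below are built from the
   standard one of [S], so no direct sum axiom is carried along. *)
Definition grading (V : lmodType S) := zdeg n -> set V.

(* The grading of [V(-b)]. *)
Definition shift_grading (V : lmodType S) (gr : grading V) (b : zdeg n) :
  grading V := fun d => gr (d - b).

Definition sub_grading (V : lmodType S) (gr : grading V) (N : submodClosed V) :
  grading (submod_of N) := fun d => [set x | gr d (val x)].

Arguments sub_grading {V} gr N.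

Definition quot_grading (V : lmodType S) (gr : grading V) (N : submodClosed V) :
  grading (quotmod N) := fun d => modproj N @` gr d.

Arguments quot_grading {V} gr N.

Definition subquot_grading (V : lmodType S) (gr : grading V)
    (N N' : submodClosed V) : grading (subquot N N') :=
  quot_grading (sub_grading gr N) (submod_in N N').
Arguments subquot_grading {V} gr N N'.

(* [N] is the sum of its intersections with the [gr d]. *)
Definition graded_submod (V : lmodType S) (gr : grading V)
    (N : submodClosed V) : Prop :=
  forall x, x \in N -> exists s : seq V,
    (forall y, y \in s -> y \in N /\ exists d, gr d y) /\ x = \sum_(y <- s) y.

Definition graded_iso (V W : lmodType S) (grV : grading V) (grW : grading W) :
  Prop :=
  exists f : {linear V -> W},
    bijective f /\ forall d x, grV d x <-> grW d (f x).

Definition poly_grading : grading S^o :=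
  fun d => [set p : S | forall m, m \in msupp p -> d = [ffun i => (m i)%:Z]].

(* Ideals of [S] are the submodules of [S^o]; they need not be proper. *)
Definition monomial_ideal (I : submodClosed S^o) : Prop :=
  exists A : set 'X_{1..n}, forall p : S, p \in I <->
    exists (s : seq 'X_{1..n}) (q : 'X_{1..n} -> S),
      (forall m, m \in s -> A m) /\ p = \sum_(m <- s) q m * 'X_[m].

Definition monomial_prime (P : submodClosed S^o) : Prop :=
  [/\ monomial_ideal P, (1 : S) \notin P & prime_idealr_closed (P : {pred S})].

(* Only the values [M i] for [i <= r] and [P i], [b i] for [i < r] matter:
   [P i] and [b i] are the prime and the shift of [M i.+1 / M i]. *)
Definition pretty_clean (V : lmodType S) (gr : grading V) : Prop :=
  exists (r : nat) (M : nat -> submodClosed V) (P : nat -> submodClosed S^o)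
      (b : nat -> zdeg n),
    [/\ (M 0%N =i pred1 0) /\ (M r =i predT),
        forall i, (i <= r)%N -> graded_submod gr (M i),
        forall i, (i < r)%N -> {subset M i <= M i.+1},
        forall i, (i < r)%N -> monomial_prime (P i) /\
          graded_iso (subquot_grading gr (M i.+1) (M i))
            (shift_grading (quot_grading poly_grading (P i)) (b i))
      & forall i j, (i < j < r)%N -> {subset P i <= P j} -> P i =i P j].

Definition pretty_clean_ring (I : submodClosed S^o) : Prop :=
  pretty_clean (quot_grading poly_grading I).

Definition monomial_span (A : set 'X_{1..n}) : set S :=
  [set p | exists (s : seq 'X_{1..n}) (c : 'X_{1..n} -> K),
    (forall m, m \in s -> A m) /\ p = \sum_(m <- s) c m *: 'X_[m]].

Lemma monomial_spanP A p :
  monomial_span A p <-> forall m, m \in msupp p -> A m.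
Proof.
split=> [[s [c [sA ->]]] m | pA]; last first.
  by exists (msupp p), (fun m => p@_m); split=> //; rewrite -mpolyE.
apply: contraPP => nAm; apply/negP; rewrite mcoeff_msupp negbK raddf_sum big_seq.
rewrite big1 // => m' /sA Am'; rewrite /= mcoeffZ mcoeffX.
by case: eqP => [eqm|]; rewrite ?mulr0 //; case: nAm; rewrite -eqm.
Qed.

Definition mc_ideal_pred (G : multicomplex n) : S^o -> bool :=
  fun p => `[< monomial_span [set e | ~ mc_set G (fin_vec e)] p >].

Fact mc_ideal_closed G : GRing.subsemimod_closed (mc_ideal_pred G).
Proof.
split; first split.
- by apply/asboolP/monomial_spanP => m; rewrite msupp0.
- move=> p q /asboolP/monomial_spanP pG /asboolP/monomial_spanP qG.
  apply/asboolP/monomial_spanP => m /msuppD_le; rewrite mem_cat.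
  by case/orP; [apply: pG | apply: qG].
- move=> a p /asboolP/monomial_spanP pG; apply/asboolP/monomial_spanP => m.
  move=> /msuppM_le /allpairsP [[m1 m2] /= [_ m2p ->]] Gm.
  apply: (pG m2 m2p); apply: (mc_setP G).1 Gm _.
  by apply/forallP => i; rewrite !ffunE /= mnmDE leq_addl.
Qed.

HB.instance Definition _ G :=
  GRing.isSubmodClosed.Build S S^o (mc_ideal_pred G) (mc_ideal_closed G).

Definition mc_ideal (G : multicomplex n) : submodClosed S^o :=
  GRing.SubmodClosed.clone S S^o (mc_ideal_pred G) _.

End Graded.

Arguments mc_ideal K {n} G.

(* Main.v *)
(* Both sides are equivalent to a filtration of the set of exponents
   [e] in [N^n] with [e] in [Gamma] by down-sets [D_0 <= ... <= D_r], [D_0]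
   empty, such that [D_(j+1)] is the disjoint union of [D_j] and a cone
   [c_j + N^(F_j)], and [i < j], [F_i <= F_j] imply [F_i = F_j].  A shelling gives
   the [D_j] as traces of the [Gamma(a_1, ..., a_j)] on [N^n].  Conversely the
   maximum [a_j] of the closure of the [j]-th cone, which is infinite on [F_j], is
   a facet: if [a_j <= a_k] with [a_k] maximal, then [F_j <= F_k], and [k < j] is
   impossible since [a_j] is new at step [j].  On the algebraic side the ideal
   spanned by the complement of [D_(r-i)] gives the [i]-th step of the filtration;
   conversely a graded isomorphism only has to be tested on the set of degrees in
   which a component is nonzero. *)
Require Import Defs.
From HB Require Import structures.
From mathcomp Require Import all_boot all_algebra.
From mathcomp Require Import boolp classical_sets.
From mathcomp Require Import mpoly.

Set Implicit Arguments.
Unset Strict Implicit.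
Unset Printing Implicit Defensive.

Import GRing.Theory.

Local Open Scope classical_set_scope.

(** * Multicomplexes and shellings *)

Lemma ninf_le_refl a : ninf_le a a.
Proof. by case: a => /=. Qed.

Lemma ninf_le_trans b a c : ninf_le a b -> ninf_le b c -> ninf_le a c.
Proof. by case: a b c => [a|] [b|] [c|] //=; apply: leq_trans. Qed.

Lemma ninf_le_anti a b : ninf_le a b -> ninf_le b a -> a = b.
Proof.
case: a b => [a|] [b|] //= ab ba; congr Some.
by apply/eqP; rewrite eqn_leq ab.
Qed.

Section Vectors.
Variable n : nat.
Implicit Types (a b m l v : nvec n) (A G T U : set (nvec n)) (F : pred 'I_n).
Implicit Types (c e : 'X_{1..n}) (s : seq (nvec n)).

Lemma vec_leP a b : reflect (forall i, ninf_le (a i) (b i)) (vec_le a b).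
Proof. exact: forallP. Qed.

Lemma vec_le_refl a : vec_le a a.
Proof. by apply/vec_leP => i; apply: ninf_le_refl. Qed.

Lemma vec_le_trans b a v : vec_le a b -> vec_le b v -> vec_le a v.
Proof.
by move=> /vec_leP ab /vec_leP bv; apply/vec_leP => i; apply: ninf_le_trans (bv i).
Qed.

Lemma vec_le_anti a b : vec_le a b -> vec_le b a -> a = b.
Proof.
by move=> /vec_leP ab /vec_leP ba; apply/ffunP => i; apply: ninf_le_anti.
Qed.

Lemma ascending_le (u : nat -> nvec n) i j :
  ascending u -> (i <= j)%N -> vec_le (u i) (u j).
Proof.
move=> u_asc /subnKC <-; elim: (j - i)%N => [|k IHk]; first by rewrite addn0 vec_le_refl.
by rewrite addnS; apply: vec_le_trans IHk (u_asc _).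
Qed.

Lemma limit_le u l a : (forall k, vec_le (u k) a) -> is_limit u l -> vec_le l a.
Proof.
move=> ua ul; apply/vec_leP => i; have {ul} := ul i.
have ui k := vec_leP _ _ (ua k) i.
case: (a i) ui => [q|] ui; last by case: (l i).
case: (l i) => [p [N /(_ N (leqnn N)) uN] | /(_ q.+1) [N /(_ N (leqnn N))]] /=.
  by move: (ui N); rewrite uN.
by move: (ui N); case: (u N i) => //= p pq /leq_trans/(_ pq); rewrite ltnn.
Qed.

(** Once a term is not below the head [a], no later term is, so a tail of the sequence is dominated
    by the remaining list. A bound for the tail bounds all earlier terms too. *)
Lemma ascending_bound (u : nat -> nvec n) s :
  ascending u -> (forall k, has (vec_le (u k)) s) ->
  exists2 a, a \in s & forall k, vec_le (u k) a.
Proof.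
elim: s u => [|a s IHs] u u_asc us; first by have := us 0%N.
have [ua | /existsNP [k0 /negP uk0]] := pselect (forall k, vec_le (u k) a).
  by exists a; rewrite ?mem_head.
have [|k|b bs ub] := IHs (fun k => u (k0 + k)%N).
- by move=> k; rewrite addnS; apply: u_asc.
- have /orP [ka|//] := us (k0 + k)%N.
  case/negP: uk0; apply: vec_le_trans ka; apply: ascending_le => //.
  exact: leq_addr.
exists b; first by rewrite inE bs orbT.
by move=> k; apply: vec_le_trans (ub k); apply: ascending_le => //; apply: leq_addl.
Qed.

Lemma downset_multicomplex s : is_multicomplex [set b | has (vec_le b) s].
Proof.
split=> [a b /= /hasP [c cs ac] ba | u l /= us u_asc ul].
  by apply/hasP; exists c => //; apply: vec_le_trans ac.
have [a as_ ua] := ascending_bound u_asc us.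
by apply/hasP; exists a => //; apply: limit_le ul.
Qed.

Lemma mc_gen_seq s : mc_gen [set` s] = [set b | has (vec_le b) s].
Proof.
apply/seteqP; split=> b.
  apply; first exact: downset_multicomplex.
  by move=> a /= as_; apply/hasP; exists a => //; apply: vec_le_refl.
by move=> /= /hasP [a as_ ba] G [G_down _] sG; apply: G_down ba; apply: sG.
Qed.

Lemma mc_gen1 m : mc_gen [set m] = [set b | vec_le b m].
Proof.
have -> : [set m] = [set` [:: m]].
  by apply/seteqP; split=> a /=; rewrite inE => /eqP.
by rewrite mc_gen_seq; apply/seteqP; split=> b /=; rewrite orbF.
Qed.

Lemma fin_vec_le e e' : vec_le (fin_vec e) (fin_vec e') = (e <= e')%MM.
Proof. by apply: eq_forallb => i; rewrite !ffunE. Qed.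

(** A point is the limit of its truncations [t k], in which infinite coordinates are replaced by
    [k]. Hence a multicomplex is determined by its trace on N^n. *)
Lemma multicomplex_finP G a : is_multicomplex G ->
  G a <-> forall e, vec_le (fin_vec e) a -> G (fin_vec e).
Proof.
move=> [G_down G_lim]; split=> [Ga e ea|Ga]; first exact: G_down ea.
pose t k := [multinom (if a i is Some q then q else k) | i < n].
apply: (G_lim (fun k => fin_vec (t k))).
- move=> k; apply: Ga; apply/vec_leP => i; rewrite ffunE mnmE.
  by case: (a i) => /=.
- move=> k; rewrite fin_vec_le; apply/mnm_lepP => i; rewrite !mnmE.
  by case: (a i).
- move=> i; case ai: (a i) => [q|].
    by exists 0%N => k _; rewrite ffunE mnmE ai.
  by move=> p; exists p => k pk; rewrite ffunE mnmE ai.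
Qed.

Definition vec_set a (i : 'I_n) x : nvec n := [ffun j => if j == i then x else a j].

Lemma vec_set_le a b i x y :
  vec_le a b -> ninf_le x y -> vec_le (vec_set a i x) (vec_set b i y).
Proof.
move=> /vec_leP ab xy; apply/vec_leP => j; rewrite !ffunE.
by case: eqP.
Qed.

Lemma vec_set_id a i : vec_set a i (a i) = a.
Proof. by apply/ffunP => j; rewrite ffunE; case: eqP => [->|]. Qed.

Lemma coordinate_max G a i : is_multicomplex G -> G a ->
  exists b, [/\ G b, vec_le a b, forall j, j != i -> b j = a j
              & forall x, G (vec_set b i x) -> ninf_le x (b i)].
Proof.
move=> mcG Ga; have [G_down _] := mcG.
have setE y x : vec_set (vec_set a i y) i x = vec_set a i x.
  by apply/ffunP => j; rewrite !ffunE; case: eqP.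
have leset x : ninf_le (a i) x -> vec_le a (vec_set a i x).
  by move=> ax; rewrite -{1}[a](vec_set_id a i) vec_set_le ?vec_le_refl.
have setN x j : j != i -> vec_set a i x j = a j.
  by move=> ji; rewrite ffunE (negPf ji).
have [Ginf | nGinf] := pselect (G (vec_set a i None)).
  exists (vec_set a i None); split=> //; [|by move=> j /setN|].
    by apply: leset; case: (a i).
  by move=> x _; rewrite ffunE eqxx; case: x.
(* If every finite value were allowed at [i], each exponent below [vec_set a i None] would lie below
   one of these points of [G], so the infinite value would be allowed too. *)
have [p nGp] : exists p, ~ G (vec_set a i (Some p)).
  apply/existsNP => Gp; apply: nGinf; apply/(multicomplex_finP _ mcG) => e ea.
  apply: G_down (Gp (e i)) _; apply/vec_leP => j.
  have := vec_leP _ _ ea j; rewrite !ffunE.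
  by case: eqP => [->|] //=.
have ai : exists q, a i = Some q.
  case ai: (a i) => [q|]; first by exists q.
  by case: nGinf; rewrite -ai vec_set_id.
have [q aiq] := ai.
have exP : exists k, `[< G (vec_set a i (Some k)) >].
  by exists q; apply/asboolP; rewrite -aiq vec_set_id.
have ubP k : `[< G (vec_set a i (Some k)) >] -> (k <= p)%N.
  move=> /asboolP Gk; rewrite leqNgt; apply/negP => pk; apply: nGp.
  by apply: G_down Gk _; apply: vec_set_le => //=; [apply: vec_le_refl | apply: ltnW].
case: (ex_maxnP exP ubP) => k /asboolP Gk kmax.
exists (vec_set a i (Some k)); split=> //; [|by move=> j /setN|].
  apply: leset; rewrite aiq /=; apply: kmax; apply/asboolP.
  by rewrite -aiq vec_set_id.
move=> x; rewrite setE ffunE eqxx; case: x => [x|] // Gx.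
by apply: kmax; apply/asboolP.
Qed.

(* Maximizing one coordinate keeps the earlier ones maximal, since [G] is
   downward closed; so a single pass over the coordinates is enough. *)
Lemma exists_maximal G a : is_multicomplex G -> G a ->
  exists2 m, maximal_elts G m & vec_le a m.
Proof.
move=> mcG Ga; have [G_down _] := mcG.
have [b [Gb ab bmax]] : exists b, [/\ G b, vec_le a b &
    forall i x, i \in enum 'I_n -> G (vec_set b i x) -> ninf_le x (b i)].
  elim: (enum 'I_n) => [|i l [b [Gb ab bmax]]].
    by exists a; split=> //; apply: vec_le_refl.
  have [c [Gc bc cE cmax]] := coordinate_max i mcG Gb.
  exists c; split=> // [|j x]; first exact: vec_le_trans bc.
  rewrite inE; case: eqP => [-> _|/eqP ji /= jl Gx]; first exact: cmax.
  rewrite cE //; apply: bmax => //; apply: G_down Gx _.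
  by apply: vec_set_le => //; apply: ninf_le_refl.
exists b => //; split=> // c Gc bc; apply: vec_le_anti => //.
apply/vec_leP => i; apply: bmax; first by rewrite mem_enum.
apply: G_down Gc _; rewrite -{2}[c](vec_set_id c i).
by apply: vec_set_le => //; apply: ninf_le_refl.
Qed.

Lemma maximal_facet G m : maximal_elts G m -> facet G m.
Proof. by case=> Gm mmax; split=> // b [Gb _] mb; rewrite (mmax b). Qed.

(* [cone c F] is [c + N^F], [cone_max c F] the maximum of its closure
   [closed_cone c F]. *)
Definition cone c F e := [forall k, (c k <= e k)%N && (F k || (e k == c k))].

Definition cone_max c F : nvec n := [ffun k => if F k then None else Some (c k)].

Definition closed_cone c F : set (nvec n) :=
  [set v | vec_le (fin_vec c) v /\ vec_le v (cone_max c F)].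

Lemma coneP c F e : cone c F e <-> closed_cone c F (fin_vec e).
Proof.
rewrite /closed_cone /= fin_vec_le; split.
  move=> /forallP ceF; split.
    by apply/mnm_lepP => k; case/andP: (ceF k).
  apply/vec_leP => k; rewrite !ffunE; case/andP: (ceF k) => _.
  by case: (F k) => //= /eqP ->.
case=> /mnm_lepP ce /vec_leP eF; apply/forallP => k; rewrite ce /=.
have := eF k; rewrite !ffunE; case: (F k) => //= ec.
by rewrite eqn_leq ec ce.
Qed.

Lemma cone_refl c F : cone c F c.
Proof. by apply/forallP => k; rewrite leqnn eqxx orbT. Qed.

Lemma fin_vec_le_cone_max c F : vec_le (fin_vec c) (cone_max c F).
Proof. by have /coneP [] := cone_refl c F. Qed.

(** The maximum of [e] and [c] stays in the cone, because off [F] the exponent [e] is already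
    bounded by [c]. So the trace of the points below [cone_max c F] is the down-closure of the
    cone. *)
Lemma below_cone_max c F e : vec_le (fin_vec e) (cone_max c F) ->
  exists2 e', cone c F e' & (e <= e')%MM.
Proof.
move=> /vec_leP eF; exists [multinom maxn (e k) (c k) | k < n]; last first.
  by apply/mnm_lepP => k; rewrite mnmE leq_maxl.
apply/forallP => k; rewrite mnmE leq_maxr /=.
have := eF k; rewrite !ffunE; case: (F k) => //= ec.
by apply/eqP/maxn_idPr.
Qed.

(** A vector with entries 0 and infinity is [cone_max 0%MM F] for its set [F] of infinite
    coordinates, so Stanley sets are exactly the closed cones. *)
Lemma stanley_withP T U : stanley_with T U <->
  exists c F, U = mc_gen [set cone_max 0%MM F] /\ T = closed_cone c F.
Proof.
have imE c F : [set vec_add (fin_vec c) t | t in mc_gen [set cone_max 0%MM F]]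
    = closed_cone c F.
  rewrite mc_gen1; apply/seteqP; split=> v /=.
    case=> t /vec_leP tF <-; split; apply/vec_leP => k.
      by rewrite !ffunE; case: (t k) => [q|] //=; rewrite leq_addr.
    have := tF k; rewrite !ffunE mnm0E; case: (F k) => //=.
      by case: (t k).
    by case: (t k) => [q|] //=; rewrite leqn0 => /eqP ->; rewrite addn0.
  case=> /vec_leP cv /vec_leP vF.
  (* Finite coordinates are translated back by [c]; infinite ones absorb the translation. *)
  exists [ffun k => if v k is Some q then Some (q - c k)%N else None].
    apply/vec_leP => k; have := vF k; rewrite !ffunE.
    case: (F k) => //; first by case: (v k).
    by case: (v k) => //= q; rewrite mnm0E leqn0 subn_eq0.
  apply/ffunP => k; have := cv k; rewrite !ffunE.
  by case: (v k) => //= q cq; rewrite subnKC.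
split=> [[c [m [m0 -> ->]]] | [c [F [-> ->]]]]; last first.
  exists c, (cone_max 0%MM F); split=> // i.
  by rewrite ffunE mnm0E; case: (F i); [right | left].
exists c, (fun k => m k == None); rewrite -imE.
suff E : m = cone_max 0%MM (fun k => m k == None) by rewrite -E.
apply/ffunP => k; rewrite ffunE mnm0E.
by case: (m0 k) => ->.
Qed.

(** [F] is the set of infinite coordinates of the largest point of the closed cone. This turns the
    order condition of a shelling into a condition on the sets [F]. *)
Lemma closed_cone_inj c c' F F' : closed_cone c F = closed_cone c' F' -> F = F'.
Proof.
have sub (c1 c2 : 'X_{1..n}) (F1 F2 : pred 'I_n) k :
    closed_cone c1 F1 = closed_cone c2 F2 -> F1 k -> F2 k.
  move=> E F1k; have : closed_cone c1 F1 (cone_max c1 F1).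
    by split; [apply: fin_vec_le_cone_max | apply: vec_le_refl].
  rewrite E => -[_ /vec_leP /(_ k)]; rewrite !ffunE F1k.
  by case: (F2 k).
move=> E; apply/funext => k; apply/idP/idP; first exact: sub E.
by apply: sub (esym E).
Qed.

Lemma stanley_with_closed_cone c F U :
  stanley_with (closed_cone c F) U <-> U = mc_gen [set cone_max 0%MM F].
Proof.
rewrite stanley_withP; split=> [[c' [F' [-> /closed_cone_inj ->]]] // | ->].
by exists c, F.
Qed.

Lemma mc_gen_cone_max_sub F F' :
  mc_gen [set cone_max 0%MM F] `<=` mc_gen [set cone_max 0%MM F'] <->
  {subset F <= F'}.
Proof.
rewrite !mc_gen1; split=> [sFF' k Fk | sFF' v /= vF].
  have /= := sFF' _ (vec_le_refl _) => /vec_leP /(_ k); rewrite !ffunE.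
  by move: Fk; rewrite !unfold_in => ->; case: (F' k).
apply: vec_le_trans vF _; apply/vec_leP => k; rewrite !ffunE.
by have := sFF' k; rewrite !unfold_in; case: (F k) => [/(_ isT) ->|_] //; case: (F' k) => /=.
Qed.

(** * Shellings and filtrations by cones *)

Lemma shell_partP s i v :
  shell_part s i v <->
  vec_le v (nth [ffun=> None] s i) /\ ~~ has (vec_le v) (take i s).
Proof.
rewrite /shell_part mc_gen1 mc_gen_seq /=.
by split=> -[va /negP].
Qed.

(* [D j] is the trace on [N^n] of the union of the first [j] shelling parts. *)
Definition stanley_filtration G r (D : nat -> set 'X_{1..n})
    (c : nat -> 'X_{1..n}) (F : nat -> pred 'I_n) : Prop :=
  [/\ (forall e, ~ D 0%N e) /\ (forall e, D r e <-> G (fin_vec e)),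
      forall j e e', D j e -> (e' <= e)%MM -> D j e',
      forall j e, (j < r)%N -> D j.+1 e <-> D j e \/ cone (c j) (F j) e,
      forall j e, (j < r)%N -> D j e -> ~~ cone (c j) (F j) e
    & forall i j, (i < j < r)%N -> {subset F i <= F j} -> F i =i F j].

Lemma shellable_filtration G : is_multicomplex G -> shellable G ->
  exists r D cs Fs, stanley_filtration G r D cs Fs.
Proof.
move=> mcG [s [_ s_facet [s_st s_ord]]].
have /choice [cF cFE] : forall j, exists cF : 'X_{1..n} * pred 'I_n,
    (j < size s)%N -> shell_part s j = closed_cone cF.1 cF.2.
  move=> j; case: (ltnP j (size s)) => [js | _]; last by exists (0%MM, xpred0).
  have [U /stanley_withP [c [F [_ ->]]]] := s_st j js.
  by exists (c, F).
pose D j : set 'X_{1..n} := [set e | has (vec_le (fin_vec e)) (take j s)].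
have coneE j e : (j < size s)%N -> cone (cF j).1 (cF j).2 e <->
    vec_le (fin_vec e) (nth [ffun=> None] s j) /\ ~~ has (vec_le (fin_vec e)) (take j s).
  by move=> js; rewrite coneP -cFE // shell_partP.
exists (size s), D, (fun j => (cF j).1), (fun j => (cF j).2); split.
- split=> [e|e]; first by rewrite /D /= take0.
  rewrite /D /= take_size; split.
    by move=> /hasP [a /s_facet [Ga _] ea]; apply: mcG.1 ea.
  (* Every point lies below a maximal one, which is a facet and hence occurs in [s]. *)
  move=> /(exists_maximal mcG) [m /maximal_facet/s_facet ms em].
  by apply/hasP; exists m.
- move=> j e e' /= /hasP [a as_ ea] e'e; apply/hasP; exists a => //.
  by apply: vec_le_trans ea; rewrite fin_vec_le.
- move=> j e js; rewrite coneE // /D /= (take_nth [ffun=> None]) // has_rcons.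
  split=> [/orP [ej|->] | [->|[-> _]]]; rewrite ?orbT //; last by left.
  by case: (boolP (has _ _)) => De; [left | right].
- by move=> j e js De; apply/negP => /(coneE _ _ js) [_ /negP].
- move=> i j /andP [ij js] sFF.
  have is_ := ltn_trans ij js.
  have st k : (k < size s)%N ->
      stanley_with (shell_part s k) (mc_gen [set cone_max 0%MM (cF k).2]).
    by move=> ks; rewrite cFE //; apply/stanley_with_closed_cone.
  have [E|] := s_ord i j _ _ is_ js (st i is_) (st j js)
    ((mc_gen_cone_max_sub _ _).2 sFF); last by rewrite ltnNge ltnW.
  suff sFF' : {subset (cF j).2 <= (cF i).2} by move=> k; apply/idP/idP; auto.
  by apply/mc_gen_cone_max_sub; rewrite E.
Qed.

(** * From a filtration by cones to a shelling *)

Section FiltrationShellable.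
Variables (G : set (nvec n)) (r : nat) (D : nat -> set 'X_{1..n}).
Variables (c : nat -> 'X_{1..n}) (F : nat -> pred 'I_n).
Hypotheses (mcG : is_multicomplex G) (filt : stanley_filtration G r D c F).

Local Notation top j := (cone_max (c j) (F j)).

(** Induction on [j]: a point below [top j] lies under a point of the [j]-th cone, hence in the
    down-set [D j.+1]. So [D j] is the trace of the multicomplex generated by the first [j] cone
    maxima. *)
Lemma filtrationE j e : (j <= r)%N ->
  D j e <-> exists2 k, (k < j)%N & vec_le (fin_vec e) (top k).
Proof.
have [[D0 _] D_down D_S _ _] := filt.
elim: j e => [|j IHj] e jr; first by split=> [/D0|[]].
rewrite D_S // IHj ?(ltnW jr) //; split.
  case=> [[k kj ek]|/coneP [_ ?]]; last by exists j.
  by exists k; rewrite ?(leq_trans kj).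
case=> k; rewrite ltnS leq_eqVlt => /orP [/eqP ->|kj] ek; last by left; exists k.
have [e' cone_e' ee'] := below_cone_max ek.
have : D j e \/ cone (c j) (F j) e.
  by apply/D_S => //; apply: D_down ee'; apply/D_S => //; right.
by case=> [/(IHj _ (ltnW jr))|]; [left | right].
Qed.

(** A point of the closed cone below an earlier maximum would put [c j] into [D j], against
    disjointness. Conversely, a new [v] dominates some exponent outside [D j]; that exponent lies in
    the cone, so [v] is above [c j]. *)
Lemma filtration_cone j v : (j < r)%N -> closed_cone (c j) (F j) v <->
  vec_le v (top j) /\ forall k, (k < j)%N -> ~~ vec_le v (top k).
Proof.
have [_ D_down D_S D_disj _] := filt.
move=> jr; split=> [[cv vF] | [vF v_new]]; first split=> //.
  move=> k kj; apply/negP => vk.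
  have Dc : D j (c j).
    by apply/(filtrationE _ (ltnW jr)); exists k => //; apply: vec_le_trans vk.
  by have := D_disj _ _ jr Dc; rewrite cone_refl.
split=> //.
have [e ev nDe] : exists2 e, vec_le (fin_vec e) v & ~ D j e.
  apply: contrapT => allD.
  have : has (vec_le v) (mkseq (fun k => top k) j).
    apply/(multicomplex_finP _ (downset_multicomplex _)) => e ev.
    have /(filtrationE _ (ltnW jr)) [k kj ek] : D j e.
      by apply: contrapT => nDe; apply: allD; exists e.
    by apply/hasP; exists (top k) => //; apply: map_f; rewrite mem_iota.
  move=> /hasP [a /mapP [k]]; rewrite mem_iota => kj -> vk.
  by have := v_new k kj; rewrite vk.
have /D_S : D j.+1 e.
  by apply/filtrationE => //; exists j => //; apply: vec_le_trans vF.
by case=> // /coneP [ce _]; apply: vec_le_trans ev.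
Qed.

Lemma filtration_cover v : G v -> exists2 j, (j < r)%N & closed_cone (c j) (F j) v.
Proof.
have [[_ DrE] _ _ _ _] := filt.
move=> Gv; have : has (vec_le v) (mkseq (fun k => top k) r).
  apply/(multicomplex_finP _ (downset_multicomplex _)) => e ev.
  have /(filtrationE _ (leqnn r)) [k kr ek] : D r e.
    by apply/DrE; apply: mcG.1 ev.
  by apply/hasP; exists (top k) => //; apply: map_f; rewrite mem_iota.
move=> /hasP [a /mapP [k]]; rewrite mem_iota => /= kr -> vk.
(* The least index whose maximum dominates [v] is that of the closed cone containing [v]. *)
have exj : exists j, (j < r)%N && vec_le v (top j) by exists k; rewrite kr.
case: (ex_minnP exj) => j /andP [jr vj] jmin.
exists j => //; apply/filtration_cone => //; split=> // i ij; apply/negP => vi.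
by have := jmin i; rewrite vi (ltn_trans ij jr) leqNgt ij => /(_ isT).
Qed.

Lemma cone_max_in j : (j < r)%N -> G (top j).
Proof.
have [[_ DrE] _ D_S _ _] := filt.
move=> jr; apply/(multicomplex_finP _ mcG) => e ej; apply/DrE.
by apply/filtrationE => //; exists j.
Qed.

Lemma cone_max_facet j : (j < r)%N -> facet G (top j).
Proof.
have [_ _ _ _ F_ord] := filt.
move=> jr; split=> [|m [Gm mmax] jm]; first exact: cone_max_in.
have [k kr /(filtration_cone _ kr) [mk _]] := filtration_cover Gm.
(* The maximal point [m] lies below the maximum of its closed cone, hence equals it. *)
have Em := mmax _ (cone_max_in kr) mk; rewrite -Em in jm *.
have sFF : {subset F j <= F k}.
  move=> i Fji; have := vec_leP _ _ jm i; rewrite !ffunE.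
  by move: Fji; rewrite !unfold_in => ->; case: (F k i).
(* With [k < j], the point [top j] of the [j]-th closed cone would lie below an earlier maximum. *)
have jk : (j <= k)%N.
  rewrite leqNgt; apply/negP => kj.
  have /(filtration_cone _ jr) [_ /(_ k kj)] : closed_cone (c j) (F j) (top j).
    by split; [apply: fin_vec_le_cone_max | apply: vec_le_refl].
  by rewrite jm.
have FE : F j =i F k.
  move: jk; rewrite leq_eqVlt => /orP [/eqP -> // | jk].
  by apply: F_ord => //; rewrite jk.
apply/seteqP; split=> i; rewrite /infpt /= !ffunE;
  by have := FE i; rewrite !unfold_in => ->; case: (F k i).
Qed.

(** Let [a] be in the [j]-th closed cone and [m] maximal above [top j]. The facet condition makes
    [a] infinite wherever [m] is, in particular on [F j]; off [F j] it is at least [c j]. So [a]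
    reaches [top j]. *)
Lemma facet_cone_max a : facet G a -> exists2 j, (j < r)%N & a = top j.
Proof.
case=> Ga a_facet; have [j jr [ca aj]] := filtration_cover Ga; exists j => //.
have [m mmax jm] := exists_maximal mcG (cone_max_in jr).
have aE := a_facet m mmax (vec_le_trans aj jm).
apply: vec_le_anti => //; apply/vec_leP => i; rewrite !ffunE.
have := vec_leP _ _ ca i; rewrite ffunE; case Fji: (F j i) => // _.
suff : infpt a i by move=> ->.
rewrite aE /infpt /=; have := vec_leP _ _ jm i; rewrite ffunE Fji.
by case: (m i).
Qed.

Lemma filtration_shellable : shellable G.
Proof.
have [_ _ _ _ F_ord] := filt.
pose s := mkseq (fun k => top k) r; exists s.
have partE j : (j < r)%N -> shell_part s j = closed_cone (c j) (F j).
  move=> jr; apply/seteqP; split=> v; rewrite filtration_cone //.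
    move/shell_partP; rewrite nth_mkseq //.
    case=> vj /hasPn v_new; split=> // k kj; apply: v_new.
    rewrite /s /mkseq -map_take take_iota; apply: map_f.
    by rewrite mem_iota /= add0n leq_min kj (ltn_trans kj).
  case=> vj v_new; apply/shell_partP; rewrite nth_mkseq //.
  split=> //; apply/hasPn => a; rewrite /s /mkseq -map_take take_iota.
  case/mapP => k; rewrite mem_iota /= add0n leq_min => /andP [kj _] ->.
  exact: v_new.
split.
- apply/mkseq_uniqP => i j; rewrite !inE => ir jr.
  wlog ij : i j ir jr / (i <= j)%N.
    by move=> wl E; case: (leqP i j) => ij; [|apply/esym]; apply: wl => //; apply: ltnW.
  move: ij; rewrite leq_eqVlt => /orP [/eqP // | ij] E.
  have /(filtration_cone _ jr) [_ /(_ i ij)] : closed_cone (c j) (F j) (top j).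
    by split; [apply: fin_vec_le_cone_max | apply: vec_le_refl].
  by rewrite E vec_le_refl.
- move=> a; split=> [/mapP [k] | /facet_cone_max [k kr ->]].
    by rewrite mem_iota => /= kr ->; apply: cone_max_facet.
  by apply: map_f; rewrite mem_iota.
split=> [j | i j Ti Tj]; rewrite size_mkseq => ir.
  rewrite partE //; exists (mc_gen [set cone_max 0%MM (F j)]).
  exact/stanley_with_closed_cone.
move=> jr; rewrite !partE //.
move=> /stanley_with_closed_cone -> /stanley_with_closed_cone ->.
move=> /mc_gen_cone_max_sub sFF.
case: (ltngtP i j) => [ij | | ->]; [left | by right | by left].
suff -> : F i = F j by [].
by apply/funext => k; have := F_ord i j _ sFF k; rewrite ij !unfold_in => ->.
Qed.

End FiltrationShellable.

Lemma shellableP G : is_multicomplex G ->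
  shellable G <-> exists r D cs Fs, stanley_filtration G r D cs Fs.
Proof.
move=> mcG; split; first exact: shellable_filtration.
by case=> r [D [c [F filt]]]; apply: filtration_shellable filt.
Qed.

End Vectors.

(** * Graded quotients *)

Local Open Scope ring_scope.

Lemma modproj_eq0 (R : nzRingType) (V : lmodType R) (I : submodClosed V) x :
  (modproj I x == 0) = (x \in I).
Proof. by rewrite -(raddf0 (modproj I)) modproj_eq subr0. Qed.

Lemma modproj_submod_in_eq (R : nzRingType) (V : lmodType R)
    (I J : submodClosed V) (x y : submod_of I) :
  (modproj (submod_in I J) x == modproj (submod_in I J) y) = (val x - val y \in J).
Proof. by rewrite modproj_eq -[RHS]/(val x - val y \in J) -raddfB. Qed.

Lemma modproj_submod_in_eq0 (R : nzRingType) (V : lmodType R)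
    (I J : submodClosed V) (x : submod_of I) :
  (modproj (submod_in I J) x == 0) = (val x \in J).
Proof. exact: modproj_eq0. Qed.

(** * Subquotients of a quotient module *)

Section QuotientImage.
Variables (R : nzRingType) (V : lmodType R).
Implicit Types (I J : submodClosed V).

Definition quot_image_pred I J : quotmod I -> bool :=
  fun x => `[< exists2 y, y \in J & modproj I y = x >].

Fact quot_image_closed I J : GRing.subsemimod_closed (@quot_image_pred I J).
Proof.
split; first split.
- by apply/asboolP; exists 0; rewrite ?rpred0 ?raddf0.
- move=> _ _ /asboolP [x xJ <-] /asboolP [y yJ <-]; apply/asboolP.
  by exists (x + y); rewrite ?rpredD ?raddfD.
- move=> a _ /asboolP [x xJ <-]; apply/asboolP.
  by exists (a *: x); rewrite ?rpredZ ?linearZ.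
Qed.

HB.instance Definition _ I J :=
  GRing.isSubmodClosed.Build R (quotmod I) (@quot_image_pred I J)
    (quot_image_closed I J).

Definition quot_image I J : submodClosed (quotmod I) :=
  GRing.SubmodClosed.clone R (quotmod I) (@quot_image_pred I J) _.

Lemma mem_quot_image I J x : {subset I <= J} ->
  (modproj I x \in quot_image I J) = (x \in J).
Proof.
move=> sIJ; apply/asboolP/idP => [[y yJ /eqP] | xJ]; last by exists x.
rewrite modproj_eq => /sIJ yxJ.
by rewrite -[x](subKr y) -scaleN1r rpredD ?rpredZ.
Qed.

Section Subclass.
Variables (I J J' : submodClosed V).
Hypotheses (sIJ : {subset I <= J}) (sJJ' : {subset J <= J'}).

Local Notation N := (quot_image I J).
Local Notation N' := (quot_image I J').

(* The class of [x] in [(J'/I)/(J/I)]; junk unless [x \in J']. *)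
Definition subclass (x : V) : subquot N' N :=
  modproj (submod_in N' N) (insubd (0 : submod_of N') (modproj I x)).

Lemma subclass_val x : x \in J' ->
  val (insubd (0 : submod_of N') (modproj I x)) = modproj I x.
Proof.
by move=> xJ'; rewrite insubdK // unfold_in mem_quot_image // => y /sIJ/sJJ'.
Qed.

Lemma subclass_eq x y : x \in J' -> y \in J' ->
  (subclass x == subclass y) = (x - y \in J).
Proof.
move=> xJ' yJ'; rewrite modproj_submod_in_eq.
by rewrite !subclass_val // -raddfB mem_quot_image.
Qed.

Lemma modproj_subclass (v : submod_of N') x : val v = modproj I x ->
  modproj (submod_in N' N) v = subclass x.
Proof. by move=> vx; congr (modproj _ _); apply: val_inj; rewrite -vx valKd. Qed.

Lemma subclass_surj v : exists2 x, x \in J' & subclass x = v.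
Proof.
(* Representatives are chosen twice: first modulo [N], then modulo [I]. *)
have [x xv] : exists x, val (modrepr v) = modproj I x.
  by exists (modrepr (val (modrepr v))); rewrite modreprK.
exists x; last by rewrite -(modproj_subclass xv) modreprK.
by rewrite -(mem_quot_image x (fun y => @sJJ' y \o @sIJ y)) -xv (valP (modrepr v)).
Qed.

Lemma subclass_linear a x y : x \in J' -> y \in J' ->
  subclass (a *: x + y) = a *: subclass x + subclass y.
Proof.
move=> xJ' yJ'; rewrite /subclass -linearP; apply: esym; apply: modproj_subclass.
by rewrite linearP /= !subclass_val // linearP.
Qed.

End Subclass.
End QuotientImage.

(** * Graded isomorphisms and degrees of nonzero components *)

Section GradedIso.
Variables (K : fieldType) (n : nat).
Local Notation S := {mpoly K[n]}.

(** The given map goes from [W] to [V] because in the application it is multiplication by a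
    monomial, defined on [S/P]. *)
Lemma graded_isoI (V W : lmodType S) (grV : grading V) (grW : grading W)
    (h : W -> V) :
  linear h -> injective h -> (forall v, exists w, h w = v) ->
  (forall d w, grV d (h w) <-> grW d w) -> graded_iso grV grW.
Proof.
move=> h_lin h_inj /choice [g gK] h_gr.
have hK : cancel h g by move=> w; apply: h_inj; rewrite gK.
have g_lin : linear g by move=> a x y; apply: h_inj; rewrite h_lin !gK.
pose gL : {linear V -> W} := HB.pack g (GRing.isLinear.Build _ _ _ _ g g_lin).
exists gL; split; first by exists h.
by move=> d x; rewrite -h_gr /= gK.
Qed.

(** The support of a graded module, an invariant of graded isomorphism from which the cones of a
    pretty clean filtration are recovered. *)
Definition nonzero_degree (V : lmodType S) (gr : grading V) : set (zdeg n) :=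
  [set d | exists2 x, gr d x & x <> 0].

Lemma graded_iso_degree (V W : lmodType S) (grV : grading V) (grW : grading W) d :
  graded_iso grV grW -> nonzero_degree grV d <-> nonzero_degree grW d.
Proof.
case=> f [[g fK gK] f_gr]; split=> [[x /f_gr gx x0] | [y gy y0]].
  by exists (f x) => // fx0; apply: x0; rewrite -[x]fK fx0 -(raddf0 f) fK.
exists (g y); first by apply/f_gr; rewrite gK.
by move=> gy0; apply: y0; rewrite -[y]gK gy0 raddf0.
Qed.

Definition mdegz (m : 'X_{1..n}) : zdeg n := [ffun i => (m i)%:Z].

Lemma mdegz_inj : injective mdegz.
Proof.
move=> m m' /ffunP E; apply/mnmP => i.
by have := E i; rewrite !ffunE => -[].
Qed.

Lemma mdegzD m m' : mdegz (m + m')%MM = mdegz m + mdegz m'.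
Proof. by apply/ffunP => i; rewrite !ffunE mnmDE PoszD. Qed.

(** Distinct monomials have distinct degrees, so a homogeneous polynomial has at most one term. *)
Lemma homogeneousP d (p : S^o) : poly_grading d p ->
  p = 0 \/ exists m a, [/\ d = mdegz m, a != 0 & p = a *: ('X_[m] : S)].
Proof.
move=> pd; have [->|p0] := eqVneq p 0; [by left | right].
have mp := mlead_supp p0; exists (mlead p), p@_(mlead p); split.
- exact: pd.
- by rewrite -mcoeff_msupp.
rewrite {1}[p]mpolyE (bigD1_seq (mlead p)) ?msupp_uniq //= big_seq_cond big1.
  by rewrite addr0.
move=> m /andP [m_p /eqP []]; apply: mdegz_inj.
by rewrite /mdegz -(pd _ m_p) -(pd _ mp).
Qed.

Lemma homogeneousX m (a : K) : poly_grading (mdegz m) (a *: ('X_[m] : S)).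
Proof. by move=> m' /msuppZ_le; rewrite msuppX inE => /eqP ->. Qed.

Lemma mem_scale_mpoly (N : submodClosed S^o) (a : K) (p : S) : a != 0 ->
  (a *: p \in N) = (p \in N).
Proof.
have sc b (q : S) : q \in N -> b *: q \in N.
  by rewrite -mul_mpolyC; apply: rpredZ.
move=> a0; apply/idP/idP; last exact: sc.
by move=> /(sc a^-1); rewrite scalerA mulVf // scale1r.
Qed.

Lemma quot_degree (P : submodClosed S^o) d :
  nonzero_degree (@quot_grading _ _ S^o (@poly_grading K n) P) d <->
  exists2 m, d = mdegz m & ('X_[m] : S) \notin P.
Proof.
split=> [[x [p pd <-] /eqP] | [m -> mP]].
  rewrite modproj_eq0; case: (homogeneousP pd) => [->|]; first by rewrite rpred0.
  by case=> m [a [-> a0 ->]]; rewrite mem_scale_mpoly // => mP; exists m.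
exists (modproj P 'X_[m]); last by apply/eqP; rewrite modproj_eq0.
by exists 'X_[m] => //; rewrite -['X_[m]]scale1r; apply: homogeneousX.
Qed.

Lemma mem_modproj_scale (I : submodClosed S^o) (N : submodClosed (quotmod I))
    (a : K) (p : S) : a != 0 ->
  (modproj I (a *: p) \in N) = (modproj I p \in N).
Proof.
have sc b (q : S) : modproj I q \in N -> modproj I (b *: q) \in N.
  by rewrite -mul_mpolyC => /(rpredZ b%:MP); rewrite -linearZ.
move=> a0; apply/idP/idP; last exact: sc.
by move=> /(sc a^-1); rewrite scalerA mulVf // scale1r.
Qed.

Lemma subquot_degree (I : submodClosed S^o) (N' N : submodClosed (quotmod I)) d :
  nonzero_degree (@subquot_grading _ _ _ (@quot_grading _ _ S^o (@poly_grading K n) I) N' N) d <->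
  exists m, [/\ d = mdegz m, modproj I 'X_[m] \in N' & modproj I 'X_[m] \notin N].
Proof.
split=> [[x [y [p pd py] <-] /eqP] | [m [-> mN' mN]]].
  rewrite modproj_submod_in_eq0 -py => pN.
  have := valP y; rewrite -py => pN'.
  case: (homogeneousP pd) => [p0|]; first by rewrite p0 raddf0 rpred0 in pN.
  case=> m [a [-> a0 pE]]; rewrite pE !mem_modproj_scale // in pN pN'.
  by exists m.
exists (modproj (submod_in N' N) (Submod mN')).
  exists (Submod mN') => //; exists 'X_[m] => //.
  by rewrite -['X_[m]]scale1r; apply: homogeneousX.
by apply/eqP; rewrite modproj_submod_in_eq0.
Qed.

End GradedIso.

(** * Monomial ideals *)

Section MonomialPrimes.
Variables (K : fieldType) (n : nat).
Local Notation S := {mpoly K[n]}.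
Implicit Types (P : submodClosed S^o) (m : 'X_{1..n}).

Lemma monomial_submodM (N : submodClosed S^o) m m' :
  ('X_[m] : S) \in N -> ('X_[m' + m] : S) \in N.
Proof. by move=> mN; rewrite mpolyXD; apply: (rpredZ ('X_[m'] : S)). Qed.

(** Primality, applied along the product of powers of variables that makes up ['X_[m]], leads to a
    variable in [P]; the other outcome, [1] in [P], is excluded. *)
Lemma monomial_prime_var P m : monomial_prime P ->
  (('X_[m] : S) \in P) = [exists k, (m k != 0)%N && (('X_k : S) \in P)].
Proof.
case=> _ P1 P_prime; apply/idP/existsP => [|[k /andP [mk kP]]]; last first.
  by rewrite -(submK (_ : (U_(k) <= m)%MM)) ?lep1mP // monomial_submodM.
rewrite mpolyXE_id => mP; apply: contrapT => noX; case/negP: P1; move: mP.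
elim: (index_enum _) => [|k s IHs]; first by rewrite big_nil.
rewrite big_cons => /P_prime /orP [|/IHs //].
suff: forall e, ('X_k : S) ^+ e \in P -> (1 : S) \in P \/ ((e != 0)%N /\ ('X_k : S) \in P).
  move=> pow /pow [//|[mk kP]]; case: noX; exists k.
  by rewrite mk.
elim=> [|e IHe]; first by rewrite expr0; left.
by rewrite exprS => /P_prime /orP [?|/IHe [?|[_ ?]]]; [right|left|right].
Qed.

(** An element of [P] is a combination of monomials of [P], and each of these is divisible by a
    variable of [P]. *)
Lemma monomial_prime_sub P P' : monomial_prime P -> monomial_prime P' ->
  (forall k, ('X_k : S) \in P -> ('X_k : S) \in P') -> {subset P <= P'}.
Proof.
move=> mP mP' sPP'; have [[A P_A] _ _] := mP.
move=> p /P_A [s [q [sA ->]]]; rewrite big_seq; apply: rpred_sum => m /sA Am.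
apply: (rpredZ (q m : S)); rewrite monomial_prime_var //.
have : ('X_[m] : S) \in P.
  apply/P_A; exists [:: m], (fun=> 1); split; last by rewrite big_seq1 mul1r.
  by move=> m'; rewrite inE => /eqP ->.
rewrite monomial_prime_var // => /existsP [k /andP [mk /sPP' kP']].
by apply/existsP; exists k; rewrite mk.
Qed.

End MonomialPrimes.

Section MonomialIdeals.
Variables (K : fieldType) (n : nat).
Local Notation S := {mpoly K[n]}.
Implicit Types (A : set 'X_{1..n}) (m : 'X_{1..n}) (F : pred 'I_n).

(* Quantifying over [m'] makes this an ideal even if [A] is not an up-set. *)
Definition up_ideal_pred A : S^o -> bool :=
  fun p => `[< forall m m', m \in msupp p -> A (m' + m)%MM >].

Fact up_ideal_closed A : GRing.subsemimod_closed (up_ideal_pred A).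
Proof.
split; first split.
- by apply/asboolP => m m'; rewrite msupp0.
- move=> p q /asboolP pA /asboolP qA; apply/asboolP => m m' /msuppD_le.
  by rewrite mem_cat => /orP [/pA|/qA].
- move=> a p /asboolP pA; apply/asboolP => m m' /msuppM_le.
  by move=> /allpairsP [[m1 m2] /= [_ /pA m2A ->]]; rewrite addmA.
Qed.

HB.instance Definition _ A :=
  GRing.isSubmodClosed.Build S S^o (up_ideal_pred A) (up_ideal_closed A).

Definition up_ideal A : submodClosed S^o :=
  GRing.SubmodClosed.clone S S^o (up_ideal_pred A) _.

Definition upset A : Prop := forall m m', A m -> A (m' + m)%MM.

Lemma up_idealP A (p : S) : upset A ->
  reflect (forall m, m \in msupp p -> A m) (p \in up_ideal A).
Proof.
move=> upA; apply: (iffP (asboolP _)) => pA m.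
  by move=> mp; have := pA m 0%MM mp; rewrite add0m.
by move=> m' /pA; apply: upA.
Qed.

Lemma up_idealX A m : upset A -> ('X_[m] : S) \in up_ideal A <-> A m.
Proof.
move=> upA; split=> [/(up_idealP _ upA) | Am].
  by apply; rewrite msuppX mem_head.
by apply/(up_idealP _ upA) => m'; rewrite msuppX inE => /eqP ->.
Qed.

Lemma up_ideal_sub A A' : A `<=` A' -> {subset up_ideal A <= up_ideal A'}.
Proof. by move=> sAA' p /asboolP pA; apply/asboolP => m m' /pA; auto. Qed.

Lemma up_ideal_monomial A : upset A -> monomial_ideal (up_ideal A).
Proof.
move=> upA; exists A => p; split=> [/(up_idealP _ upA) pA | [s [q [sA ->]]]].
  exists (msupp p), (fun m => (p@_m)%:MP); split=> //.
  by rewrite {1}[p]mpolyE; apply: eq_bigr => m _; rewrite mul_mpolyC.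
rewrite big_seq; apply: rpred_sum => m /sA Am.
by apply: (rpredZ (q m : S)); apply/up_idealX.
Qed.

Definition off F : set 'X_{1..n} := [set m | exists2 k, ~~ F k & (m k != 0)%N].

Lemma off_upset F : upset (off F).
Proof.
by move=> m m' [k Fk mk]; exists k; rewrite // mnmDE addn_eq0 negb_and mk orbT.
Qed.

Local Notation kill F := [tuple (if F k then 'X_k else 0) | k < n].

Lemma kill_monomial F m : 'X_[m] \mPo kill F = (if `[< off F m >] then 0 else 'X_[m]) :> S.
Proof.
rewrite comp_mpolyX; case: asboolP => [[k Fk mk] | on_m].
  by rewrite (bigD1 k) //= tnth_mktuple (negPf Fk) expr0n (negPf mk) mul0r.
rewrite mpolyXE_id; apply: eq_bigr => k _; rewrite tnth_mktuple.
case: (boolP (F k)) => // Fk; case: (eqVneq (m k) 0%N) => [-> // | mk].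
by case: on_m; exists k.
Qed.

(* [up_ideal (off F)] is the ideal of the variables outside [F]: the kernel of
   the endomorphism [kill F] of the domain [S]. *)
Lemma off_kernel F (p : S) : p \in up_ideal (off F) = (p \mPo kill F == 0).
Proof.
apply/(up_idealP _ (@off_upset F))/eqP => [p_off | p0 m mp].
  rewrite [p]mpolyE raddf_sum big_seq big1 // => m /p_off off_m.
  by rewrite /= comp_mpolyZ kill_monomial asboolT // scaler0.
apply: contrapT => on_m; move: mp; rewrite mcoeff_msupp => /eqP; apply.
(* The substitution fixes monomials outside [off F] and kills the others, so it preserves the
   coefficient at [m]. *)
transitivity ((p \mPo kill F)@_m); last by rewrite p0 mcoeff0.
rewrite comp_mpolyEX {1}[p]mpolyE !raddf_sum.
apply: eq_bigr => m' _; rewrite /= kill_monomial !mcoeffZ.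
case: asboolP => // off_m'; rewrite mcoeff0 mcoeffX.
by case: eqP => [E|]; rewrite ?mulr0 //; case: on_m; rewrite -E.
Qed.

Lemma off_prime F : monomial_prime (up_ideal (off F)).
Proof.
split; first exact/up_ideal_monomial/off_upset.
  by rewrite off_kernel comp_mpoly1 oner_neq0.
by move=> p q; rewrite !off_kernel rmorphM mulf_eq0.
Qed.

Lemma offE F m : ~ off F m <-> cone 0%MM F m.
Proof.
split=> [on_m | /forallP cm [k Fk mk]].
  apply/forallP => k; rewrite mnm0E /=; case: (boolP (F k)) => //= Fk.
  by apply/negPn/negP => mk; apply: on_m; exists k.
by have := cm k; rewrite mnm0E (negPf Fk) (negPf mk).
Qed.

Lemma cone_translate c F m : cone c F m <-> exists2 m', m = (c + m')%MM & cone 0%MM F m'.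
Proof.
split=> [/forallP cm | [m' -> /forallP cm']].
  exists (m - c)%MM.
    by rewrite addmC submK //; apply/mnm_lepP => k; case/andP: (cm k).
  apply/forallP => k; have := cm k; rewrite mnmBE mnm0E /= => /andP [_].
  by case: (F k) => //= /eqP ->; rewrite subnn.
apply/forallP => k; have := cm' k; rewrite mnmDE mnm0E leq_addr /=.
by case: (F k) => //= /eqP ->; rewrite addn0.
Qed.

Lemma mc_ideal_up (G : multicomplex n) :
  mc_ideal K G =i up_ideal [set m | ~ mc_set G (fin_vec m)].
Proof.
have up : upset [set m | ~ mc_set G (fin_vec m)].
  move=> m m' nGm Gm; apply: nGm; apply: (mc_setP G).1 Gm _.
  by rewrite fin_vec_le lem_addl.
by move=> p; apply/asboolP/(up_idealP _ up) => /monomial_spanP.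
Qed.

(** * The subquotient attached to one cone *)

Section Step.
Variables (I : submodClosed S^o) (A A' : set 'X_{1..n}).
Variables (c : 'X_{1..n}) (F : pred 'I_n).
Hypotheses (upA : upset A) (upA' : upset A') (sAA' : A `<=` A').
Hypothesis sIA : {subset I <= up_ideal A}.
Hypothesis step : forall m, A' m /\ ~ A m <-> cone c F m.

Local Notation P := (up_ideal (off F)).
Local Notation sJJ' := (up_ideal_sub sAA').

Lemma step_shift_in (p : S) : 'X_[c] * p \in up_ideal A'.
Proof.
rewrite mulrC; apply: (rpredZ (p : S)); apply/(up_idealX _ upA').
by have [_ /(_ (cone_refl c F)) []] := step c.
Qed.

(** This computes the colon ideal of [up_ideal A] by ['X_[c]]. As [c + m] always lies in [A'], it
    avoids [A] exactly when it is in the cone, that is, when [m] is supported on [F]. *)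
Lemma step_colon (p : S) : ('X_[c] * p \in up_ideal A) = (p \in P).
Proof.
apply/(up_idealP _ upA)/(up_idealP _ (@off_upset F)) => pA m.
  move=> mp; apply: contrapT => /offE on_m.
  have /step [_] : cone c F (c + m)%MM by apply/cone_translate; exists m.
  apply; apply: pA; rewrite mcoeff_msupp mulrC mcoeffMX.
  by rewrite -mcoeff_msupp.
move=> /msuppM_le /allpairsP [[m1 m2] /= [+ /pA off_m2 ->]].
rewrite msuppX inE => /eqP ->; apply: contrapT => nA.
have /step/cone_translate [m' /addmI <- /offE //] : A' (c + m2)%MM /\ ~ A (c + m2)%MM.
split=> //; have /(up_idealP _ upA') := step_shift_in ('X_[m2] : S).
by apply; rewrite -mpolyXD msuppX mem_head.
Qed.

Lemma step_surj (p : S) : p \in up_ideal A' ->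
  exists q, 'X_[c] * q - p \in up_ideal A.
Proof.
move=> /(up_idealP _ upA') pA'.
(* The terms of [p] in the cone are divided by ['X_[c]]; the remaining exponents are in [A'] but not
   in the cone, hence in [A]. *)
exists (\sum_(m <- msupp p | cone c F m) p@_m *: 'X_[m - c]).
rewrite mulr_sumr [X in _ - X](mpolyE p) [X in _ - X](bigID (cone c F)) /= opprD addrA.
rewrite -sumrB big1 ?add0r => [|m /cone_translate [m' -> _]]; last first.
  have -> : (c + m' - c = m')%MM by rewrite addmC addmK.
  by rewrite -scalerAr -mpolyXD subrr.
rewrite -mulN1r; apply: (rpredZ (-1 : S)); rewrite big_seq_cond.
apply: rpred_sum => m /andP [mp ncone]; rewrite -mul_mpolyC.
apply: (rpredZ (_%:MP : S)); apply/(up_idealX _ upA); apply: contrapT => nA.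
by case/negP: ncone; apply/step; split=> //; apply: pA'.
Qed.

(** The inverse isomorphism is multiplication by ['X_[c]]: well defined and injective by
    [step_colon], surjective by [step_surj], and raising degrees by [mdegz c]. *)
Lemma step_iso :
  graded_iso
    (@subquot_grading _ _ _ (@quot_grading _ _ S^o (@poly_grading K n) I)
      (quot_image I (up_ideal A')) (quot_image I (up_ideal A)))
    (shift_grading (@quot_grading _ _ S^o (@poly_grading K n) P) (mdegz c)).
Proof.
pose cls := @subclass _ _ I (up_ideal A) (up_ideal A').
have clsE p q : cls ('X_[c] * p) = cls ('X_[c] * q) <-> modproj P p = modproj P q.
  split=> /eqP.
    rewrite (subclass_eq sIA sJJ') ?step_shift_in // -mulrBr step_colon => pq.
    by apply/eqP; rewrite modproj_eq.
  rewrite modproj_eq -step_colon mulrBr => pq; apply/eqP.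
  by rewrite (subclass_eq sIA sJJ') ?step_shift_in.
pose h (x : quotmod P) := cls ('X_[c] * (modrepr x : S)).
have hE p : h (modproj P p) = cls ('X_[c] * p) by apply/clsE; rewrite modreprK.
have h_inj : injective h.
  by move=> x y /clsE; rewrite !modreprK.
apply: (@graded_isoI _ _ _ _ _ _ h).
- move=> a x y; rewrite -[x]modreprK -[y]modreprK -linearP !hE.
  rewrite /cls -(subclass_linear sIA sJJ') ?step_shift_in //; congr (subclass _ _ _ _).
  by rewrite mulrDr; congr (_ + _); rewrite mulrCA.
- exact: h_inj.
- move=> v; have [p pA' <-] := subclass_surj sIA sJJ' v.
  have [q qp] := step_surj pA'; exists (modproj P q); rewrite hE.
  by apply/eqP; rewrite (subclass_eq sIA sJJ') ?step_shift_in.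
move=> d x; split=> [[y [p pd py] yx] | [q qd <-]]; last first.
  rewrite hE; exists (insubd 0 (modproj I ('X_[c] * q))) => //.
  exists ('X_[c] * q); last by rewrite (subclass_val sIA sJJ') ?step_shift_in.
  move=> m /msuppM_le /allpairsP [[m1 m2] /= [+ /qd dE ->]].
  by rewrite msuppX inE => /eqP ->; rewrite -/(mdegz _) mdegzD -[mdegz m2]dE addrC subrK.
have hx : h x = cls p by rewrite -yx; apply: modproj_subclass.
have pA' : p \in up_ideal A'.
  rewrite -(mem_quot_image p (fun z => @sJJ' z \o @sIA z)) py.
  exact: (valP y).
have x_eq q : cls ('X_[c] * q) = cls p -> modproj P q = x.
  by move=> E; apply: h_inj; rewrite hE hx.
(* If [p] is in [up_ideal A], then [x] is 0, which is homogeneous of every degree. Otherwise [p] is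
   a single term with exponent in the cone, and dividing it by ['X_[c]] gives a homogeneous
   representative of [x]. *)
case: (boolP (p \in up_ideal A)) => [pA | pA].
  exists 0 => [m|]; first by rewrite msupp0.
  apply: x_eq; apply/eqP; rewrite (subclass_eq sIA sJJ') ?step_shift_in // mulr0 sub0r.
  by rewrite -scaleN1r rpredZ.
case: (homogeneousP pd) pA pA' => [->|]; first by rewrite rpred0.
move=> [m [a [dE a0 pE]]]; rewrite {1 2}pE !mem_scale_mpoly //.
move=> /negP nA /up_idealX - /(_ upA') A'm.
have /step/cone_translate [m' mE _] : A' m /\ ~ A m.
  by split=> // Am; apply: nA; apply/up_idealX.
exists (a *: 'X_[m']).
  by rewrite dE mE mdegzD addrC addKr; apply: homogeneousX.
by apply: x_eq; rewrite pE mE mpolyXD scalerAr.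
Qed.

End Step.
End MonomialIdeals.

(** * Pretty clean filtrations *)

Section PrettyClean.
Variables (K : fieldType) (n : nat) (G : multicomplex n).
Local Notation S := {mpoly K[n]}.
Local Notation I := (mc_ideal K G).

Lemma mc_idealX m : (('X_[m] : S) \in I) = ~~ `[< mc_set G (fin_vec m) >].
Proof.
apply/asboolP/idP => [/monomial_spanP | /asboolPn nGm].
  by move=> XG; apply/asboolPn; apply: XG; rewrite msuppX mem_head.
by apply/monomial_spanP => m'; rewrite msuppX inE => /eqP ->.
Qed.

Lemma filtration_pretty_clean r D c F :
  stanley_filtration G r D c F -> pretty_clean_ring I.
Proof.
case=> -[D0 DrE] D_down D_S D_disj F_ord.
have ltn_sub_pred i : (i < r)%N -> (r - i.+1 < r)%N.
  by move=> ir; rewrite ltn_subrL (leq_ltn_trans _ ir).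
(* Complements reverse inclusion, so passing from [A i] to [A i.+1] adds the cone of index
   [r - i.+1]. *)
pose A i : set 'X_{1..n} := [set m | ~ D (r - i)%N m].
have upA i : upset (A i).
  by move=> m m' nDm Dm; apply: nDm; apply: D_down Dm _; apply: lem_addl.
have AS i : (i < r)%N -> A i `<=` A i.+1.
  move=> ir m /= nD D'; apply: nD; rewrite -subnSK //.
  by apply/D_S; [exact: ltn_sub_pred | left].
have sA i : (i <= r)%N -> A 0%N `<=` A i.
  elim: i => [|i IHi] ir //; apply: (subset_trans (IHi (ltnW ir))); exact: AS.
have IE : I =i up_ideal K (A 0%N).
  move=> p; rewrite mc_ideal_up; congr (p \in up_ideal K _).
  by apply/funext => m; apply/propext; rewrite /A /= subn0 DrE.
have sI i : (i <= r)%N -> {subset I <= up_ideal K (A i)}.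
  by move=> ir p; rewrite IE; apply: up_ideal_sub; apply: sA.
pose M i := quot_image I (up_ideal K (A i)).
have memM i p : (i <= r)%N -> (modproj I p \in M i) = (p \in up_ideal K (A i)).
  by move=> ir; rewrite mem_quot_image //; apply: sI.
exists r, M, (fun i => up_ideal K (off (F (r - i.+1)%N))),
  (fun i => mdegz (c (r - i.+1)%N)); split.
- split=> x; rewrite -[x]modreprK memM //.
    by rewrite -IE inE modproj_eq0.
  rewrite inE; apply/(up_idealP _ (upA r)) => m _.
  by rewrite /A /= subnn; apply: D0.
- move=> i ir x; rewrite -[x]modreprK; move: (modrepr x : S) => p; rewrite memM //.
  move=> /(up_idealP _ (upA i)) pA.
  exists [seq modproj I (p@_m *: 'X_[m]) | m <- msupp p]; split.
    move=> _ /mapP [m mp ->]; split; last first.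
      by exists (mdegz m), (p@_m *: 'X_[m]) => //; apply: homogeneousX.
    rewrite memM // -mul_mpolyC; apply: (rpredZ (_%:MP : S)).
    by apply/(up_idealX _ _ (upA i)); apply: pA.
  by rewrite big_map {1}[p]mpolyE raddf_sum.
- move=> i ir x; rewrite -[x]modreprK !memM // 1?ltnW //.
  by apply: up_ideal_sub; apply: AS.
- move=> i ir; split; first exact: off_prime.
  apply: step_iso => //; [exact: AS | exact/sI/ltnW|].
  move=> m; rewrite /A /= -(subnSK ir).
  have jr := ltn_sub_pred i ir.
  split=> [[nD /contrapT /D_S] | cone_m]; first by case.
  split; last by apply; apply/D_S => //; right.
  by move=> /D_disj -/(_ jr); rewrite cone_m.
move=> i j /andP [ij jr] sP p.
(* Inclusion of primes reverses inclusion of the sets [F], and the indices are reversed as well, so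
   the two order conditions match. *)
have sF k : F (r - j.+1)%N k -> F (r - i.+1)%N k.
  move=> Fjk; apply: contrapT => /negP Fik.
  have /sP/(up_idealX _ _ (@off_upset _ _)) [k' Fk'] :
      ('X_k : S) \in up_ideal K (off (F (r - i.+1)%N)).
    by apply/(up_idealX _ _ (@off_upset _ _)); exists k; rewrite // mnm1E eqxx.
  by rewrite mnm1E eqb0 negbK => /eqP kk'; rewrite -kk' Fjk in Fk'.
congr (p \in up_ideal K (off _)); apply/funext => k.
have /F_ord -/(_ sF k) : (r - j.+1 < r - i.+1 < r)%N.
  have ir := ltn_trans ij jr; rewrite ltn_sub_pred // andbT.
  by apply: ltn_sub2l => //; apply: leq_ltn_trans jr.
by rewrite !unfold_in.
Qed.

Lemma pretty_clean_filtration : pretty_clean_ring I ->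
  exists r D cs Fs, stanley_filtration G r D cs Fs.
Proof.
case=> r [M [P [b [[M0 Mr] _ M_S MP P_ord]]]].
have ltn_sub_pred i : (i < r)%N -> (r - i.+1 < r)%N.
  by move=> ir; rewrite ltn_subrL (leq_ltn_trans _ ir).
pose x m := modproj I ('X_[m] : S).
pose F i : pred 'I_n := fun k => ('X_k : S) \notin P i.
have P_onE i m : (i < r)%N -> ('X_[m] : S) \notin P i <-> cone 0%MM (F i) m.
  move=> ir; rewrite monomial_prime_var; last by case: (MP i ir).
  rewrite negb_exists; split=> /forallP H; apply/forallP => k; move: (H k);
    by rewrite mnm0E /F /=; case: (_ \in P i); case: (m k == 0%N).
have degE i d : (i < r)%N ->
    (exists m, [/\ d = mdegz m, x m \in M i.+1 & x m \notin M i]) <->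
    exists2 m, d - b i = mdegz m & ('X_[m] : S) \notin P i.
  move=> ir; have [_ /graded_iso_degree iso] := MP i ir.
  by rewrite -subquot_degree -quot_degree; apply: iso.
(* As [1] is not in [P i], the component of degree [b i] is nonzero. It is hit by a monomial of [S],
   so [b i] has no negative entry. *)
have /choice [c cE] : forall i, exists c, (i < r)%N -> b i = mdegz c.
  move=> i; case: (ltnP i r) => [ir|_]; last by exists 0%MM.
  have [|c [-> _ _]] := (degE i (b i) ir).2; last by exists c.
  exists 0%MM; first by apply/ffunP => k; rewrite subrr !ffunE mnm0E.
  by apply/(P_onE _ _ ir); apply: cone_refl.
(* Equality of supports, with the shift [b i] written as [mdegz (c i)], says that the monomials
   gained at step [i] form a cone. *)
have step i m : (i < r)%N ->
    (x m \in M i.+1 /\ x m \notin M i) <-> cone (c i) (F i) m.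
  move=> ir; rewrite cone_translate; split=> [[xM' xM] | [m' mE /(P_onE _ _ ir) m'P]].
    have [|m' dE /(P_onE _ _ ir) cone_m'] := (degE i (mdegz m) ir).1; first by exists m.
    exists m' => //; apply: (@mdegz_inj n).
    by rewrite mdegzD -dE -(cE _ ir) addrC subrK.
  have [|m2 [/mdegz_inj -> //]] := (degE i (mdegz m) ir).2.
  by exists m' => //; rewrite mE mdegzD cE // addrC addKr.
(* [D j] collects the monomials surviving modulo [M (r - j)], from none at [j = 0] to the whole
   trace of [G] at [j = r]. *)
exists r, (fun j => [set m | x m \notin M (r - j)%N]),
  (fun j => c (r - j.+1)%N), (fun j => F (r - j.+1)%N); split.
- split=> m /=; first by rewrite subn0 Mr.
  by rewrite subnn M0 inE modproj_eq0 mc_idealX negbK; split=> /asboolP.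
- move=> j m m' /= xm m'm; apply: contra xm => xm'.
  rewrite -(submK m'm) /x mpolyXD.
  by move/(rpredZ ('X_[m - m'] : S)): xm'; rewrite /x -linearZ.
- move=> j m jr /=.
  have ir := ltn_sub_pred j jr; rewrite -(step _ _ ir).
  have sM := M_S _ ir (x m); rewrite subnSK // in sM *.
  split=> [xM' | [xj | [] //]]; last by apply: contra xj.
  by case: (boolP (x m \in M (r - j)%N)) => xj; [right | left].
- move=> j m jr /= xm.
  by apply/negP => /(step _ _ (ltn_sub_pred j jr)); rewrite subnSK // (negPf xm) => -[].
move=> i j /andP [ij jr] sF.
have ir := ltn_trans ij jr.
have i'r := ltn_sub_pred i ir.
have j'i' : (r - j.+1 < r - i.+1)%N.
  by apply: ltn_sub2l => //; apply: leq_ltn_trans jr.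
have j'r := ltn_trans j'i' i'r.
have [mPi mPj] := (proj1 (MP _ i'r), proj1 (MP _ j'r)).
have sP : {subset P (r - j.+1)%N <= P (r - i.+1)%N}.
  apply: monomial_prime_sub => // k kPj; apply: contrapT => /negP kPi.
  by have := sF k kPi; rewrite unfold_in /F kPj.
move=> k; apply/esym; apply: (congr1 negb (P_ord _ _ _ sP 'X_k)).
by rewrite j'i'.
Qed.

End PrettyClean.

Theorem theorem10p5 (K : fieldType) (n : nat) (G : multicomplex n) :
  shellable G <-> pretty_clean_ring (mc_ideal K G).
Proof.
rewrite (shellableP (mc_setP G)); split; last exact: pretty_clean_filtration.
by case=> r [D [c [F filt]]]; apply: filtration_pretty_clean filt.
Qed.
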